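(* For any real number $\overline x$, there is a lower semicontinuous function $\psi:\mathbb{R}\to\mathbb{R}$ such that, with $\overline\psi=\psi(\overline x)$, whenever $\eta>0$ and $\nu>0$ satisfy $\mathfrak{B}(\overline x;\eta,\nu)\ne\emptyset$, the level-set subdifferential error bound condition for $\psi$ holds at $\overline x$ (over $\mathfrak{B}(\overline x;\eta,\nu)$), but the KL property for $\psi$ fails at $\overline x$ (over $\mathfrak{B}(\overline x;\eta,\nu)$, for every exponent $\alpha\in(0,1)$).
   Context: $\mathfrak{B}(\overline x;\eta,\nu)=\{x\in\mathbb{R}:|x-\overline x|<\eta,\ \overline\psi<\psi(x)<\overline\psi+\nu\}$; $[\psi\le\overline\psi]=\{x:\psi(x)\le\overline\psi\}$; $\mathrm{dist}(x,C)=\inf_{z\in C}|x-z|$ ($=\infty$ if $C=\emptyset$). $\partial_P\psi(\bar x)=\{\xi:\exists\rho>0,r>0\text{ s.t. }\psi(x)\ge\psi(\bar x)+\xi(x-\bar x)-\rho|x-\bar x|^2\ \text{for all }|x-\bar x|<r\}$ is the proximal subdifferential; $\partial_L\psi$ is the limiting (Mordukhovich) subdifferential. Level-set subdifferential error bound at $\overline x$ over $\mathfrak{B}(\overline x;\eta,\nu)$: there are an exponent $\gamma>0$ and $c_3>0$ with $\mathrm{dist}^\gamma(x,[\psi\le\overline\psi])\le c_3\,\mathrm{dist}(0,\partial_P\psi(x))$ for all $x\in\mathfrak{B}(\overline x;\eta,\nu)$. KL property at $\overline x$ with exponent $\alpha\in(0,1)$ over $\mathfrak{B}(\overline x;\eta,\nu)$: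 there is $c_1>0$ with $\mathrm{dist}(0,\partial_L\psi(x))\ge c_1[\psi(x)-\overline\psi]^\alpha$ for all $x\in\mathfrak{B}(\overline x;\eta,\nu)$. *)

(* Defs.v *)
From mathcomp Require Import all_boot all_order all_algebra.
From mathcomp Require Import all_classical all_reals all_analysis.
Import Order.TTheory GRing.Theory Num.Theory.
Import numFieldNormedType.Exports.

Set Implicit Arguments.
Unset Strict Implicit.
Unset Printing Implicit Defensive.

Local Open Scope classical_set_scope.
Local Open Scope ring_scope.

(* The infimum is taken in [\bar R], so that the distance to [set0] is [+oo]. *)
Definition dist_set (R : realType) (x : R) (C : set R) : \bar R :=
  ereal_inf [set `|x - z|%:E | z in C].

Definition sublevel (R : realType) (psi : R -> R) (v : R) : set R :=
  [set x | psi x <= v].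

Definition frakB (R : realType) (psi : R -> R) (xbar eta nu : R) : set R :=
  [set x | `|x - xbar| < eta /\ psi xbar < psi x < psi xbar + nu].

Definition prox_subdiff (R : realType) (psi : R -> R) (xbar : R) : set R :=
  [set xi | exists rho r : R, [/\ 0 < rho, 0 < r &
    forall x : R, `|x - xbar| < r ->
      psi xbar + xi * (x - xbar) - rho * `|x - xbar| ^+ 2 <= psi x]].

(* [psi x >= psi xbar + xi (x - xbar) + o(|x - xbar|)] as [x --> xbar]; only
   the lower bound is subject to the little-o, hence the epsilon form. *)
Definition frechet_subdiff (R : realType) (psi : R -> R) (xbar : R) : set R :=
  [set xi | forall eps : R, 0 < eps -> \forall x \near xbar,
    psi xbar + xi * (x - xbar) - eps * `|x - xbar| <= psi x].

(* Limits of Frechet subgradients along [psi]-attentive sequences. *)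
Definition lim_subdiff (R : realType) (psi : R -> R) (xbar : R) : set R :=
  [set xi | exists u g : R^nat,
    [/\ u @ \oo --> xbar, psi (u n) @[n --> \oo] --> psi xbar,
        forall n, frechet_subdiff psi (u n) (g n) & g @ \oo --> xi]].

Definition levelset_error_bound (R : realType) (psi : R -> R)
    (xbar eta nu : R) : Prop :=
  exists gamma c3 : R, [/\ 0 < gamma, 0 < c3 &
    forall x, frakB psi xbar eta nu x ->
      (poweR (dist_set x (sublevel psi (psi xbar))) gamma
         <= c3%:E * dist_set 0 (prox_subdiff psi x))%E].

Definition KL_property (R : realType) (psi : R -> R)
    (xbar alpha eta nu : R) : Prop :=
  exists2 c1 : R, 0 < c1 &
    forall x, frakB psi xbar eta nu x ->
      ((c1 * powR (psi x - psi xbar) alpha)%:E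
         <= dist_set 0 (lim_subdiff psi x))%E.

(* Main.v *)
Require Import Defs.
From mathcomp Require Import all_boot all_order all_algebra.
From mathcomp Require Import all_classical all_reals all_analysis.
From mathcomp Require Import ring lra.
Import Order.TTheory GRing.Theory Num.Theory.
Import numFieldNormedType.Exports.

Local Open Scope classical_set_scope.
Local Open Scope ring_scope.

(** A jump separates the two conditions.  Take [psi] equal to [0] on
    [x <= xbar] and to [1 + (x - xbar)^2] on [x > xbar].  To the right of
    [xbar] the function is smooth with derivative [2 (x - xbar)], which is
    twice the distance to the sublevel set [x <= xbar]; so the error bound
    holds with exponent [1] ([prox_subdiff_jump_ge]).  The same derivative
    tends to [0] as [x] decreases to [xbar] ([lim_subdiff_jump]), whereas the
    gap [psi x - psi xbar] stays above [1] there, and so does each of its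
    powers: no positive multiple of a power of the gap can bound the
    subgradients from below.  When [nu <= 1] the jump makes [frakB] empty;
    once [frakB] contains a point, it contains all the points between [xbar]
    and that one, so that [x] may indeed approach [xbar] inside it. *)

Section JumpParabola.
Context {R : realType}.
Implicit Types a x y t xi eta nu : R.

Definition jump_parabola a x : R := if x <= a then 0 else 1 + (x - a) ^+ 2.

Lemma jump_parabola_left {a x} : x <= a -> jump_parabola a x = 0.
Proof. by rewrite /jump_parabola => ->. Qed.

Lemma jump_parabola_right {a x} :
  a < x -> jump_parabola a x = 1 + (x - a) ^+ 2.
Proof. by rewrite /jump_parabola leNgt => ->. Qed.

Lemma jump_parabola_ge0 a x : 0 <= jump_parabola a x.
Proof.
by rewrite /jump_parabola; case: ifP => // _; rewrite addr_ge0 ?sqr_ge0.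
Qed.

(** The points [x <= a], including the jump point, are global minimizers, where
    lower semicontinuity is automatic; on [x > a] the function is continuous. *)
Lemma jump_parabola_lsc a :
  lower_semicontinuous (fun x => (jump_parabola a x)%:E).
Proof.
move=> x c; rewrite lte_fin; have [xa|ax] := leP x a.
  rewrite (jump_parabola_left xa) => c0; exists setT; first exact: filterT.
  by move=> y _; rewrite lte_fin (lt_le_trans c0)// jump_parabola_ge0.
rewrite (jump_parabola_right ax) => cx.
have cvg_parabola : 1 + (y - a) ^+ 2 @[y --> x] --> 1 + (x - a) ^+ 2.
  apply: cvgD; first exact: cvg_cst.
  by apply: cvgM; (apply: cvgB; [exact: cvg_id|exact: cvg_cst]).
exists [set y | a < y /\ c < 1 + (y - a) ^+ 2].
  apply: filterI; first exact: lt_nbhsr.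
  exact: (cvgr_gt _ cvg_parabola).
by move=> y [ay cy]; rewrite lte_fin (jump_parabola_right ay).
Qed.

(** Testing the proximal inequality at [x - t] gives
    [xi >= 2 (x - a) - (1 + rho) t]; let [t] decrease to [0]. *)
Lemma prox_subdiff_jump_ge a x xi : a < x ->
  prox_subdiff (jump_parabola a) x xi -> 2 * (x - a) <= xi.
Proof.
move=> ax [rho [r [rho0 r0 H]]]; rewrite leNgt; apply/negP => xi_lt.
set b := (2 * (x - a) - xi) / (2 * (1 + rho)).
have b0 : 0 < b by apply: divr_gt0; lra.
(* [t] keeps [x - t] within [r] of [x] and right of [a], and absorbs half of
   the assumed gap between [xi] and [2 (x - a)]. *)
pose t := Num.min (r / 2) (Num.min ((x - a) / 2) b).
have t0 : 0 < t by rewrite !lt_min b0 !divr_gt0// subr_gt0.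
have tr : t <= r / 2 by rewrite ge_min lexx.
have ta : t <= (x - a) / 2 by rewrite !ge_min lexx ?orbT.
have tb : t <= b by rewrite !ge_min lexx ?orbT.
have tb' : t * (2 * (1 + rho)) <= 2 * (x - a) - xi.
  by rewrite -ler_pdivlMr//; lra.
have dist_t : `|x - t - x| = t by rewrite addrAC subrr add0r normrN gtr0_norm.
have axt : a < x - t by lra.
have := H (x - t); rewrite dist_t (jump_parabola_right ax).
rewrite (jump_parabola_right axt) => /(_ ltac:(lra)) ineq.
have : t * (2 * (x - a) - xi) <= t * (t * (1 + rho)) by lra.
rewrite ler_pM2l//; lra.
Qed.

(** The parabola lies above its tangent lines, so the derivative is already a
    Frechet subgradient and constant sequences witness it as a limiting one. *)
Lemma lim_subdiff_jump a x : a < x ->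
  lim_subdiff (jump_parabola a) x (2 * (x - a)).
Proof.
move=> ax; exists (fun=> x), (fun=> 2 * (x - a)).
split=> [||_ eps eps0|]; [exact: cvg_cst|exact: cvg_cst| |exact: cvg_cst].
near=> y.
have ay : a < y by near: y; exact: lt_nbhsr.
rewrite (jump_parabola_right ax) (jump_parabola_right ay).
have := sqr_ge0 (y - x); have := mulr_ge0 (ltW eps0) (normr_ge0 (y - x)).
by move: (eps * _) => e; lra.
Unshelve. all: by end_near. Qed.

Lemma frakB_jump a eta nu x : frakB (jump_parabola a) a eta nu x ->
  [/\ a < x, x - a < eta & 1 + (x - a) ^+ 2 < nu].
Proof.
rewrite /frakB /= (jump_parabola_left (lexx a)) add0r => -[xeta].
have [xa|ax] := leP x a; first by rewrite (jump_parabola_left xa) ltxx.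
rewrite (jump_parabola_right ax) => /andP[_ ->]; split=> //.
by apply: le_lt_trans xeta; rewrite ler_norm.
Qed.

Lemma frakB_jump_right a eta nu t :
  0 < t -> t < eta -> 1 + t ^+ 2 < nu ->
  frakB (jump_parabola a) a eta nu (a + t).
Proof.
move=> t0 teta tnu; rewrite /frakB /= (jump_parabola_left (lexx a)) add0r.
rewrite jump_parabola_right ?ltrDl// addrAC subrr add0r gtr0_norm// tnu andbT.
by split=> //; rewrite ltr_pwDl// sqr_ge0.
Qed.

Lemma levelset_error_bound_jump a eta nu :
  levelset_error_bound (jump_parabola a) a eta nu.
Proof.
exists 1, 2^-1; split=> // x /frakB_jump[ax _ _].
have dist_ge0 : (0 <= dist_set x (sublevel (jump_parabola a)
    (jump_parabola a a)))%E.
  by apply: le_ereal_inf_tmp => _ [z _ <-]; rewrite lee_fin.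
rewrite poweRe1//; apply: (@le_trans _ _ (x - a)%:E).
  apply: ereal_inf_lbound; exists a; first exact: lexx.
  by rewrite gtr0_norm// subr_gt0.
have -> : (x - a)%:E = ((2^-1)%:E * (2 * (x - a))%:E)%E.
  by rewrite -EFinM; congr EFin; field.
apply: lee_wpmul2l; first by rewrite lee_fin.
apply: le_ereal_inf_tmp => _ [xi /(prox_subdiff_jump_ge _ _ _ ax) xi_ge <-].
by rewrite lee_fin sub0r normrN (le_trans xi_ge)// ler_norm.
Qed.

(** At distance [t] to the right of [a], a KL inequality would give
    [c1 <= c1 (1 + t^2)^alpha <= 2 t] for arbitrarily small [t]. *)
Lemma KL_property_jump_fails a alpha eta nu : 0 <= alpha ->
  frakB (jump_parabola a) a eta nu !=set0 ->
  ~ KL_property (jump_parabola a) a alpha eta nu.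
Proof.
move=> alpha0 [x /frakB_jump[ax xeta xnu]] [c1 c10 KL].
pose t := Num.min (x - a) (c1 / 4).
have t0 : 0 < t by rewrite lt_min subr_gt0 ax divr_gt0.
have tx : t <= x - a by rewrite ge_min lexx.
have tc : t <= c1 / 4 by rewrite ge_min lexx orbT.
have tB : frakB (jump_parabola a) a eta nu (a + t).
  apply: frakB_jump_right => //; first exact: le_lt_trans xeta.
  by apply: le_lt_trans xnu; rewrite lerD2l lerXn2r// nnegrE ltW// subr_gt0.
have at_gt : a < a + t by rewrite ltrDl.
have subgrad_le :
    (dist_set 0 (lim_subdiff (jump_parabola a) (a + t)) <= (2 * t)%:E)%E.
  apply: ereal_inf_lbound; exists (2 * (a + t - a)).
    exact: lim_subdiff_jump.
  by rewrite sub0r normrN addrAC subrr add0r gtr0_norm// mulr_gt0.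
have := le_trans (KL _ tB) subgrad_le.
rewrite lee_fin (jump_parabola_left (lexx a)) subr0 jump_parabola_right//.
rewrite [a + t]addrC addrK => KLt.
have pow_ge1 : 1 <= powR (1 + t ^+ 2) alpha.
  by rewrite -[leLHS](powRr0 (1 + t ^+ 2)) ler_powR// lerDl sqr_ge0.
have : c1 <= c1 * powR (1 + t ^+ 2) alpha by rewrite ler_peMr// ltW.
lra.
Qed.

End JumpParabola.

Theorem proposition7p2 (R : realType) (xbar : R) :
  exists psi : R -> R,
    [/\ lower_semicontinuous (fun x => (psi x)%:E),
        exists eta nu : R, [/\ 0 < eta, 0 < nu & frakB psi xbar eta nu !=set0]
      & forall eta nu : R, 0 < eta -> 0 < nu -> frakB psi xbar eta nu !=set0 ->
          levelset_error_bound psi xbar eta nu /\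
          (forall alpha : R, 0 < alpha < 1 ->
             ~ KL_property psi xbar alpha eta nu)].
Proof.
exists (jump_parabola xbar); split; first exact: jump_parabola_lsc.
  exists 2, 3; split=> //; exists (xbar + 1).
  by apply: frakB_jump_right => //; lra.
move=> eta nu _ _ B_nonempty; split; first exact: levelset_error_bound_jump.
move=> alpha /andP[alpha0 _]; apply: KL_property_jump_fails B_nonempty.
exact: ltW.
Qed.
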